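(* Let $m,n\ge 1$, let $A_1, \dots, A_m \in M_n(\mathbb{C})$ be positive semi-definite matrices, and let $r \in \{1\}\cup [2,\infty)$. Let $K=\{1,\dots,m\}$, let $K_j=\{J\subseteq K:|J|=j\}$ for $1\le j\le m$, and for each nonempty $J\subseteq K$ let $A_J=\sum_{j\in J}A_j$. Then for all integers $1\le k<\ell< p\le m$ and any generalized matrix function $d=d_\chi^G$ on $M_n(\mathbb{C})$, $$\frac{\ell-k}{p\binom{m}{p}}\sum_{J\in K_p} d(A_J)^r +\frac{p-\ell}{k\binom{m}{k}}\sum_{J\in K_k} d(A_J)^r\ \ge\ \frac{p-k}{\ell\binom{m}{\ell}} \sum_{J\in K_\ell} d(A_J)^r.$$
   Context: $M_n(\mathbb{C})$ denotes the $n\times n$ complex matrices; positive semi-definite matrices are Hermitian. Let $G$ be a subgroup of the symmetric group $S_n$ and let $\chi$ be a linear (i.e. degree-one complex) character of $G$. The generalized matrix function associated with $G$ and $\chi$ is $d_\chi^G(A)=\sum_{\sigma\in G}\chi(\sigma)\prod_{i=1}^n a_{i\,\sigma(i)}$ for $A=(a_{ij})\in M_n(\mathbb{C})$. On positive semi-definite matrices its values are nonnegative real numbers, so real powers make sense. *)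

(* Defs.v *)
From mathcomp Require Export all_boot all_order all_algebra all_fingroup.
From mathcomp Require Export mxrepresentation complex reals exp.

Set Implicit Arguments.
Unset Strict Implicit.
Unset Printing Implicit Defensive.

Import Order.TTheory GRing.Theory Num.Theory Num.Def.
Local Open Scope ring_scope.
Local Open Scope complex_scope.
Local Open Scope sesquilinear_scope.

(* The order on R[i] is partial: 0 <= z means that z is a nonnegative real. *)
Definition psdmx (R : realType) (n : nat) (A : 'M[R[i]]_n) : Prop :=
  A \is hermsymmx /\ forall x : 'cV[R[i]]_n, 0 <= (x ^t* *m A *m x) 0 0.

Definition linear_character (R : realType) (gT : finGroupType)
    (G : {group gT}) (chi : gT -> R[i]) : Prop :=
  exists rG : mx_representation R[i] G 1,
    forall s : gT, s \in G -> chi s = \tr (rG s).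

Definition gen_matrix_fun (R : realType) (n : nat) (G : {group 'S_n})
    (chi : 'S_n -> R[i]) (A : 'M[R[i]]_n) : R[i] :=
  \sum_(s in G) chi s * \prod_(i < n) A i (s i).

(* The values of d are nonnegative reals on positive semi-definite matrices,
   so taking the real part only moves d(A_J) from R[i] to R. *)
Definition sum_pow (R : realType) (m n : nat) (d : 'M[R[i]]_n -> R[i])
    (A : 'I_m -> 'M[R[i]]_n) (r : R) (j : nat) : R :=
  \sum_(J : {set 'I_m} | #|J| == j) (complex.Re (d (\sum_(i in J) A i))) `^ r.

(* Main.v *)
(* Write c_s for chi(s)^*. Multiplying the defining sum of d by |G| and
   reindexing gives |G| d(X) = \sum_(s, t in G) c_s chi(t) \prod_i X_(s i, t i),
   the quadratic form of the n-fold tensor power of X at a fixed vector.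
   Expanding the power of A_J over maps f from the n tensor factors to J shows
   that d(A_J) = \sum_(S subset J) w(S) for weights w(S) >= 0, so all iterated
   differences of J |-> d(A_J) are nonnegative. Since x^r is nondecreasing and
   convex and, for r >= 2 (or r = 1), has a convex derivative, the third
   differences of F(J) = d(A_J)^r are still nonnegative. This is what makes
   j |-> (mean of F over j-subsets) / j convex, and the inequality is this
   convexity at k < l < p. *)
Require Import Defs.
From mathcomp Require boolp classical_sets topology normedtype derive realfun.
From mathcomp Require Import ring lra.

Set Implicit Arguments.
Unset Strict Implicit.
Unset Printing Implicit Defensive.

Import Order.TTheory GRing.Theory Num.Theory.
Local Open Scope ring_scope.
Local Open Scope complex_scope.
Local Open Scope sesquilinear_scope.

(** * Set functions with nonnegative third differences, summed by cardinality *)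

Definition third_diff (R : zmodType) (V : finType) (F : {set V} -> R)
    (T : {set V}) (a b c : V) : R :=
  F T - F (T :\ a) - F (T :\ b) - F (T :\ c)
  + F (T :\ a :\ b) + F (T :\ a :\ c) + F (T :\ b :\ c) - F (T :\ a :\ b :\ c).

Lemma sum_pairs_const (R : nzRingType) (V : finType) (U : {set V}) (h : V -> R) :
  \sum_(b in U) \sum_(c in U :\ b) h b = (#|U|%:R - 1) * \sum_(b in U) h b.
Proof.
rewrite mulr_sumr; apply: eq_bigr => b bU.
by rewrite sumr_const (cardsD1 b U) bU natrD addrC addrA addNr add0r mulr_natl.
Qed.

Lemma sum_pairs_swap (R : nmodType) (V : finType) (U : {set V}) (h : V -> V -> R) :
  \sum_(b in U) \sum_(c in U :\ b) h b c = \sum_(b in U) \sum_(c in U :\ b) h c b.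
Proof.
rewrite (exchange_big_dep (mem U)) /=; last by move=> b c _ /setD1P[].
apply: eq_bigr => c cU; apply: eq_bigl => b.
by rewrite !inE cU andbT eq_sym andbC.
Qed.

(* With W the Moebius transform of F, the right-hand side minus the left-hand
   side is \sum_(S \subset T) (#|S| - 1) * (#|S| - 2) * W S, and deleting a from
   T changes it by \sum_(b, c) of the third differences of F along a, b, c. *)
Lemma deletion_ineq (R : realDomainType) (V : finType) (F : {set V} -> R) :
  0 <= F set0 ->
  (forall (T : {set V}) a b c, a \in T -> b \in T :\ a -> c \in T :\ a :\ b ->
     0 <= third_diff F T a b c) ->
  forall T : {set V},
  2 * (#|T|%:R - 2) * \sum_(a in T) F (T :\ a) <=
  (#|T|%:R - 1) * (#|T|%:R - 2) * F T
  + \sum_(b in T) \sum_(c in T :\ b) F (T :\ b :\ c).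
Proof.
move=> F0 F3 T; elim: {T}#|T| {-2}T (erefl #|T|) => [|N IH] T cT.
  (* At the empty set the claim reads [0 <= 2 * F set0]. *)
  have -> : T = set0 by apply/eqP; rewrite -cards_eq0 cT.
  by rewrite !big_set0 cards0; lra.
have /card_gt0P[a aT] : (0 < #|T|)%N by rewrite cT.
set U := T :\ a; have cU : #|U| = N by move: cT; rewrite (cardsD1 a) aT => -[].
have cTU : #|T|%:R = #|U|%:R + 1 :> R by rewrite cT cU -natr1.
have := IH U cU.
have : 0 <= \sum_(b in U) \sum_(c in U :\ b) third_diff F T a b c.
  by apply: sumr_ge0 => b bU; apply: sumr_ge0 => c cUb; apply: F3.
have sepT (h : V -> R) : \sum_(x in T) h x = h a + \sum_(x in U) h x.
  by rewrite (big_setD1 a).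
(* The ordered pairs with [b = a] and those with [c = a] contribute the same sum over [U], hence the
   factor 2. *)
have -> : \sum_(b in T) \sum_(c in T :\ b) F (T :\ b :\ c) =
    2 * (\sum_(b in U) F (U :\ b))
    + \sum_(b in U) \sum_(c in U :\ b) F (T :\ b :\ c).
  rewrite sepT mulr_natl mulr2n -addrA; congr (_ + _).
  rewrite -big_split; apply: eq_bigr => b /setD1P[ba bT] /=.
  by rewrite (big_setD1 a) ?inE 1?eq_sym ?ba //= ![T :\ b :\ a]setDDl setUC -setDDl.
rewrite sepT -/U cTU /third_diff.
under eq_bigr do rewrite !(big_split, sumrN) /=.
rewrite !(big_split, sumrN) /= !sum_pairs_const.
rewrite (sum_pairs_swap _ (fun _ c => F (T :\ c))).
rewrite (sum_pairs_swap _ (fun _ c => F (U :\ c))) !sum_pairs_const !sumr_const -/U.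
rewrite -!(mulr_natl (F _)).
set X1 := \sum_(b in U) F (T :\ b); set X2 := \sum_(b in U) F (U :\ b).
set Y1 := \sum_(b in U) \sum_(c in _) F (T :\ b :\ c).
set Y2 := \sum_(b in U) \sum_(c in _) F (U :\ b :\ c).
move: (#|U|%:R : R) (F T) (F U) => n x y; nra.
Qed.

(** Double counting: a set [U] of size [j] arises as [T :\ a] once for each [a] outside [U]. *)
Lemma sum_card_deletion (R : nzRingType) (V : finType) (H : {set V} -> R) (j : nat) :
  \sum_(T : {set V} | #|T| == j.+1) \sum_(a in T) H (T :\ a)
  = (#|V|%:R - j%:R) * \sum_(U : {set V} | #|U| == j) H U.
Proof.
rewrite (exchange_big_dep predT) //=.
transitivity (\sum_(a : V) \sum_(U : {set V} | (#|U| == j) && (a \notin U)) H U).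
  apply: eq_bigr => a _.
  rewrite (reindex_onto (fun U => a |: U) (fun T => T :\ a)) /=; last first.
    by move=> T /andP[_ aT]; rewrite setD1K.
  have eqU U : (a |: U) :\ a = U <-> a \notin U.
    split=> [<-|aU]; first by rewrite !inE eqxx.
    by rewrite setU1K.
  rewrite [LHS](eq_bigl (fun U : {set V} => (#|U| == j) && (a \notin U))).
    by apply: eq_bigr => U /andP[_ /eqU ->].
  move=> U; rewrite !inE eqxx andbT.
  case: (boolP (a \in U)) => aU.
    rewrite andbF; apply/negbTE/nandP; right; apply/eqP => /eqU.
    by rewrite aU.
  by rewrite cardsU1 aU eqSS; move/eqU: (aU) => ->; rewrite eqxx.
rewrite (exchange_big_dep (fun U : {set V} => #|U| == j)) /=; last first.
  by move=> ? ? _ /andP[].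
rewrite mulr_sumr; apply: eq_bigr => U /eqP cU.
rewrite (eq_bigl (mem (~: U))) => [|a]; last by rewrite /= inE cU eqxx.
by rewrite sumr_const -(cardsC U) cU natrD addrAC subrr add0r mulr_natl.
Qed.

Lemma card_sum_ineq (R : realDomainType) (V : finType) (F : {set V} -> R) :
  0 <= F set0 ->
  (forall (T : {set V}) a b c, a \in T -> b \in T :\ a -> c \in T :\ a :\ b ->
     0 <= third_diff F T a b c) ->
  let S j := \sum_(J : {set V} | #|J| == j) F J in
  forall j : nat,
  2 * j%:R * (#|V|%:R - j%:R - 1) * S j.+1 <=
  (j%:R + 1) * j%:R * S j.+2 + (#|V|%:R - j%:R - 1) * (#|V|%:R - j%:R) * S j.
Proof.
move=> F0 F3 S j.
(* [deletion_ineq] is summed over sets of size [j.+2]; deleting two points reaches size [j], so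
   double counting is applied twice to the last term. *)
have : \sum_(T : {set V} | #|T| == j.+2)
      2 * (j.+2%:R - 2) * \sum_(a in T) F (T :\ a) <=
    \sum_(T : {set V} | #|T| == j.+2)
      ((j.+2%:R - 1) * (j.+2%:R - 2) * F T
       + \sum_(b in T) \sum_(c in T :\ b) F (T :\ b :\ c)).
  by apply: ler_sum => T /eqP cT; have := deletion_ineq F0 F3 T; rewrite cT.
rewrite big_split /= (sum_card_deletion (fun U => \sum_(c in U) F (U :\ c))).
rewrite -!mulr_sumr !sum_card_deletion -/(S j) -/(S j.+1).
rewrite -/(S j.+2) -!natr1.
by move: (S j) (S j.+1) (S j.+2) => x y z; lra.
Qed.

(** Both chord slopes, over [k, l] and over [l, p], are compared with the step [phi l.+1 - phi l].
    Convexity is assumed only from [k] on because the intended [phi] divides by its index and has no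
    meaning at 0. *)
Lemma convex_seq_three_points (R : realDomainType) (phi : nat -> R) (k l p : nat) :
  (forall j, (k <= j)%N -> (j.+2 <= p)%N -> 2 * phi j.+1 <= phi j + phi j.+2) ->
  (k < l)%N -> (l < p)%N ->
  (p%:R - k%:R) * phi l <= (l%:R - k%:R) * phi p + (p%:R - l%:R) * phi k.
Proof.
move=> cvx kl lp.
have slope i j : (k <= i)%N -> (i <= j)%N -> (j < p)%N ->
    phi i.+1 - phi i <= phi j.+1 - phi j.
  move=> ki; elim: j => [|j IH]; first by rewrite leqn0 => /eqP ->.
  rewrite leq_eqVlt => /predU1P[-> //|ij jp].
  have := IH ij (ltnW jp); have := cvx j (leq_trans ki ij) jp; lra.
have up d : (l + d <= p)%N -> d%:R * (phi l.+1 - phi l) <= phi (l + d)%N - phi l.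
  elim: d => [_|d IH ld]; first by rewrite addn0 mul0r subrr.
  rewrite addnS in ld *; have := IH (ltnW ld).
  by have := slope l (l + d)%N (ltnW kl) (leq_addr _ _) ld; rewrite -natr1; lra.
have down d : (k + d <= l)%N -> phi (k + d)%N - phi k <= d%:R * (phi l.+1 - phi l).
  elim: d => [_|d IH ld]; first by rewrite addn0 mul0r subrr.
  rewrite addnS in ld *; have := IH (ltnW ld).
  by have := slope (k + d)%N l (leq_addr _ _) (ltnW ld) lp; rewrite -natr1; lra.
have := up (p - l)%N; rewrite subnKC ?(ltnW lp)// => /(_ (leqnn _)).
have := down (l - k)%N; rewrite subnKC ?(ltnW kl)// => /(_ (leqnn _)).
rewrite !natrB ?(ltnW kl) ?(ltnW lp)//.
have : 0 < l%:R - k%:R :> R by rewrite subr_gt0 ltr_nat.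
have : 0 < p%:R - l%:R :> R by rewrite subr_gt0 ltr_nat.
move: (l%:R : R) (k%:R : R) (p%:R : R) (phi l.+1) (phi l) (phi k) (phi p).
move=> L K P s x y z h1 h2 h3 h4.
have : (P - L) * (x - y) <= (P - L) * ((L - K) * (s - x)) by rewrite ler_pM2l.
have : (L - K) * ((P - L) * (s - x)) <= (L - K) * (z - x) by rewrite ler_pM2l.
nra.
Qed.

Lemma card_mean_convex (R : realFieldType) (V : finType) (F : {set V} -> R) (j : nat) :
  0 <= F set0 ->
  (forall (T : {set V}) a b c, a \in T -> b \in T :\ a -> c \in T :\ a :\ b ->
     0 <= third_diff F T a b c) ->
  let phi i := (\sum_(J : {set V} | #|J| == i) F J) / (i%:R * 'C(#|V|, i)%:R) in
  (0 < j)%N -> (j.+2 <= #|V|)%N -> 2 * phi j.+1 <= phi j + phi j.+2.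
Proof.
move=> F0 F3 phi j0 jm; have := card_sum_ineq F0 F3 j; rewrite /phi.
set S := fun i => \sum_(J : {set V} | #|J| == i) F J; rewrite -!/(S _) /=.
(* This expresses all three denominators through ['C(#|V|, j)]; what remains is [card_sum_ineq]
   divided by the positive common denominator [D0]. *)
have binS i : (i <= #|V|)%N -> i.+1%:R * 'C(#|V|, i.+1)%:R
    = (#|V|%:R - i%:R) * 'C(#|V|, i)%:R :> R.
  by move=> im; rewrite -natrM mul_bin_left natrM natrB.
have := binS j.+1 (ltnW jm); have := binS j (ltnW (ltnW jm)).
have B0 : 0 < 'C(#|V|, j)%:R :> R by rewrite ltr0n bin_gt0 (ltnW (ltnW jm)).
have j0' : 0 < j%:R :> R by rewrite ltr0n.
have d2 : 0 < #|V|%:R - j%:R - 1 :> R.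
  by rewrite -addrA -opprD natr1 subr_gt0 ltr_nat.
move=> e1 e2; rewrite e1 e2.
have -> : 'C(#|V|, j.+1)%:R = (#|V|%:R - j%:R) * 'C(#|V|, j)%:R / j.+1%:R :> R.
  by rewrite -e1 mulrAC mulfV ?mul1r// pnatr_eq0.
rewrite -[j.+1%:R]natr1.
move: B0 j0' d2; move: (S j) (S j.+1) (S j.+2) => x y z.
move: (#|V|%:R) ('C(_, _)%:R) (j%:R) => m B q B0 q0 d2 H.
have d1 : 0 < m - q by lra.
have D0 : 0 < q * B * (m - q) * (m - q - 1) by rewrite !mulr_gt0.
rewrite -subr_ge0 -(pmulr_rge0 _ D0).
suff -> : q * B * (m - q) * (m - q - 1) * (x / (q * B) +
   z / ((m - (q + 1)) * ((m - q) * B / (q + 1))) - 2 * (y / ((m - q) * B)))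
  = (q + 1) * q * z + (m - q - 1) * (m - q) * x - 2 * q * (m - q - 1) * y.
  by rewrite subr_ge0.
field.
by rewrite !gt_eqF//; lra.
Qed.

(** * Monotonicity of finite differences of real powers *)

Section powR_differences.
Import boolp classical_sets topology normedtype derive realfun.
Import numFieldNormedType.Exports.
Local Open Scope classical_set_scope.

Lemma continuous_powR_ge0 (R : realType) (r a b : R) : 0 < r -> 0 <= a -> a < b ->
  {within `[a, b], continuous (@powR R ^~ r)}.
Proof.
move=> r0 a0 ab.
have cts x : 0 < x -> {for x, continuous (@powR R ^~ r)}.
  move=> x0; apply/differentiable_continuous/derivable1_diffP.
  by apply: derivable_powR; rewrite in_itv /= x0.
apply/(continuous_within_itvP _ ab); split.
- by move=> x; rewrite in_itv /= => /andP[ax _]; apply: cts; apply: le_lt_trans ax.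
(* The endpoint 0 escapes the differentiability argument: right continuity there uses [0 < r]. *)
- move: a0; rewrite le_eqVlt => /predU1P[<-|a0]; last first.
    by apply: cvg_at_right_filter; apply: cts.
  by rewrite powR0 ?gt_eqF//; apply: powR_cvg0.
- by apply: cvg_at_left_filter; apply: cts; apply: le_lt_trans ab.
Qed.

Lemma ge0_derive_le (R : realType) (f df : R -> R) (a b : R) : a <= b ->
  {within `[a, b], continuous f} ->
  (forall x, x \in `]a, b[%R -> is_derive x 1 f (df x)) ->
  (forall x, x \in `]a, b[%R -> 0 <= df x) -> f a <= f b.
Proof.
rewrite le_eqVlt => /predU1P[-> //|ab] cf fdf df0.
have [c cab] := MVT ab fdf cf; rewrite -subr_ge0 => ->.
by rewrite mulr_ge0 ?df0// subr_ge0 ltW.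
Qed.

Lemma is_derive_powR_shift (R : realType) (r s x : R) : 0 < x + s ->
  is_derive x 1 (fun v : R => (v + s) `^ r) (r * (x + s) `^ (r - 1)).
Proof.
move=> xs; have := @is_derive1_comp _ (@powR R ^~ r) (shift s) x _ _
  (is_derive1_powR r xs) (is_derive_shift x 1 s).
by rewrite mulr1.
Qed.

Lemma continuous_powR_shift (R : realType) (r a b s : R) : 0 < r -> 0 <= a -> a < b ->
  0 <= s -> {within `[a, b], continuous (fun v : R => (v + s) `^ r)}.
Proof.
move=> r0 a0 ab; rewrite le_eqVlt => /predU1P[<-|s0].
  rewrite (_ : (fun v => _) = @powR R ^~ r); last by apply/funext => v; rewrite addr0.
  exact: continuous_powR_ge0.
apply: derivable_within_continuous => x; rewrite in_itv /= => /andP[ax _].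
have xs : 0 < x + s by rewrite ltr_wpDl// (le_trans a0).
by case: (is_derive_powR_shift r xs).
Qed.

Lemma powR_increment_le (R : realType) (r v w s : R) : 1 <= r ->
  0 <= v -> v <= w -> 0 <= s ->
  (v + s) `^ r - v `^ r <= (w + s) `^ r - w `^ r.
Proof.
move=> r1 v0; rewrite le_eqVlt => /predU1P[-> //|vw] s0.
have r0 : 0 < r by lra.
(* The term [x + 0] lets the lemmas on shifted powers treat both summands alike. *)
pose f (x : R) := (x + s) `^ r - (x + 0) `^ r.
suff : f v <= f w by rewrite /f !addr0.
apply: (@ge0_derive_le _ f (fun x => r * (x + s) `^ (r - 1) - r * (x + 0) `^ (r - 1))).
- exact: ltW.
- by apply: within_continuousB; apply: continuous_powR_shift.
- move=> x; rewrite in_itv /= => /andP[vx _].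
  have x0 : 0 < x + 0 by rewrite addr0 (le_lt_trans v0).
  have xs : 0 < x + s by rewrite (lt_le_trans x0)// lerD2l.
  by apply: is_deriveB; apply: is_derive_powR_shift.
move=> x; rewrite in_itv /= => /andP[vx _].
have x0 : 0 <= x by rewrite (le_trans v0)// ltW.
rewrite -mulrBr mulr_ge0 ?(ltW r0)// subr_ge0.
by apply: ge0_ler_powR; rewrite ?nnegrE ?lerD2l//; lra.
Qed.

(* The second difference has derivative r times a second difference of
   x `^ (r - 1), which is nonnegative as r - 1 >= 1. *)
Lemma powR_second_diff_le (R : realType) (r v w s t : R) : 2 <= r ->
  0 <= v -> v <= w -> 0 <= s -> 0 <= t ->
  (v + (s + t)) `^ r - (v + s) `^ r - ((v + t) `^ r - v `^ r) <=
  (w + (s + t)) `^ r - (w + s) `^ r - ((w + t) `^ r - w `^ r).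
Proof.
move=> r2 v0; rewrite le_eqVlt => /predU1P[-> //|vw] s0 t0.
have r0 : 0 < r by lra.
pose f (x : R) := (x + (s + t)) `^ r - (x + s) `^ r - ((x + t) `^ r - (x + 0) `^ r).
suff : f v <= f w by rewrite /f !addr0.
have st0 : 0 <= s + t by lra.
pose g (x y : R) := r * (x + y) `^ (r - 1).
apply: (@ge0_derive_le _ f (fun x => g x (s + t) - g x s - (g x t - g x 0))).
- exact: ltW.
- apply: within_continuousB; apply: within_continuousB;
  exact: continuous_powR_shift.
- move=> x; rewrite in_itv /= => /andP[vx _].
  have x0 : 0 < x by lra.
  by apply: is_deriveB; apply: is_deriveB; apply: is_derive_powR_shift; lra.
move=> x; rewrite in_itv /= => /andP[vx _].
have x0 : 0 <= x by lra.
rewrite /g -!mulrBr mulr_ge0 ?(ltW r0)// subr_ge0 addr0 addrA.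
by apply: powR_increment_le; lra.
Qed.

End powR_differences.

(** For [r = 1] the two sides collapse to [c] and [c']. Otherwise the arguments are raised one at a
    time: [u] by the second difference and an increment, [a] and [b] by increments, [c] by
    monotonicity. *)
Lemma powR_cross_diff_le (R : realType) (r u u' a a' b b' c c' : R) :
  r = 1 \/ 2 <= r ->
  0 <= u <= u' -> 0 <= a <= a' -> 0 <= b <= b' -> 0 <= c <= c' ->
  (u + a + b + c) `^ r - (u + a) `^ r - (u + b) `^ r + u `^ r <=
  (u' + a' + b' + c') `^ r - (u' + a') `^ r - (u' + b') `^ r + u' `^ r.
Proof.
move=> [->|r2] /andP[u0 uu] /andP[a0 aa] /andP[b0 bb] /andP[c0 cc].
  by rewrite !powRr1; lra.
have r1 : 1 <= r by lra.
have := powR_second_diff_le r2 u0 uu a0 b0; rewrite !addrA.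
have := @powR_increment_le _ r (u + a + b) (u' + a + b) c r1.
have := @powR_increment_le _ r (u' + a) (u' + a') (b + c) r1; rewrite !addrA.
have := @powR_increment_le _ r (u' + b) (u' + b') (a' + c) r1; rewrite !addrA.
rewrite ![u' + _ + a']addrAC.
have : (u' + a' + b' + c) `^ r <= (u' + a' + b' + c') `^ r.
  by apply: ge0_ler_powR; rewrite ?nnegrE; lra.
move=> h1 h2 h3 h4 h5.
have {}h2 := h2 ltac:(lra) ltac:(lra) ltac:(lra).
have {}h3 := h3 ltac:(lra) ltac:(lra) ltac:(lra).
have {}h4 := h4 ltac:(lra) ltac:(lra) ltac:(lra).
lra.
Qed.

(** * Third differences of powers of cover sums *)

Definition cover_sum (R : nmodType) (I V : finType) (P : I -> {set V}) (w : I -> R)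
    (J : {set V}) : R := \sum_(i | P i \subset J) w i.

Lemma third_diff_powR_ge0 (R : realType) (I V : finType) (P : I -> {set V})
    (w : I -> R) (r : R) (T : {set V}) (a b c : V) :
  (forall i, 0 <= w i) -> r = 1 \/ 2 <= r ->
  0 <= third_diff (fun J => cover_sum P w J `^ r) T a b c.
Proof.
move=> w0 hr.
pose chi (i : I) (J : {set V}) : R := (P i \subset J)%:R.
have gE J : cover_sum P w J = \sum_i w i * chi i J.
  rewrite /cover_sum big_mkcond; apply: eq_bigr => i _.
  by rewrite /chi; case: ifP; rewrite ?mulr1 ?mulr0.
rewrite /third_diff.
set g := cover_sum P w.
have chiD i J x : chi i (J :\ x) = chi i J * (x \notin P i)%:R.
  by rewrite /chi subsetD1 -natrM mulnb.
(* The unprimed arguments are the value, the two first differences and the mixed difference of [g]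
   along [a] and [b] after deleting [c]; the primed ones are the same without deleting [c]. *)
have := @powR_cross_diff_le R r (g (T :\ a :\ b :\ c)) (g (T :\ a :\ b))
  (g (T :\ b :\ c) - g (T :\ a :\ b :\ c)) (g (T :\ b) - g (T :\ a :\ b))
  (g (T :\ a :\ c) - g (T :\ a :\ b :\ c)) (g (T :\ a) - g (T :\ a :\ b))
  (g (T :\ c) - g (T :\ a :\ c) - g (T :\ b :\ c) + g (T :\ a :\ b :\ c))
  (g T - g (T :\ a) - g (T :\ b) + g (T :\ a :\ b)) hr.
have sumE (u x y z : R) : u + (x - u) + (y - u) + (z - y - x + u) = z by ring.
rewrite sumE [X in _ <= X `^ _ - _ - _ + _](_ : _ = g T); last by ring.
rewrite !(subrKC (g _)).
suff H : [/\ 0 <= g (T :\ a :\ b :\ c) <= g (T :\ a :\ b),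
  0 <= g (T :\ b :\ c) - g (T :\ a :\ b :\ c) <= g (T :\ b) - g (T :\ a :\ b),
  0 <= g (T :\ a :\ c) - g (T :\ a :\ b :\ c) <= g (T :\ a) - g (T :\ a :\ b) &
  0 <= g (T :\ c) - g (T :\ a :\ c) - g (T :\ b :\ c) + g (T :\ a :\ b :\ c) <=
  g T - g (T :\ a) - g (T :\ b) + g (T :\ a :\ b)].
  by case: H => h1 h2 h3 h4 /(_ h1 h2 h3 h4); lra.
have chi0 i : 0 <= chi i T by rewrite ler0n.
(* Each inequality holds term by term: the coefficient of [w i * chi i T] is a polynomial in three
   0/1 indicators, checked in all cases. *)
split; apply/andP; split; rewrite -subr_ge0 /g !gE;
  do ?[rewrite -sumrB | rewrite -big_split /=]; rewrite ?subr0.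
all: apply: sumr_ge0 => i _; have := mulr_ge0 (w0 i) (chi0 i); rewrite /= !chiD;
  do 3 case: (_ \notin _); rewrite ?(mulr0, mulr1); lra.
Qed.

(** * Positivity of generalized matrix functions *)

Lemma psdmx_gram (R : realType) (n : nat) (A : 'M[R[i]]_n) : psdmx A ->
  exists L : 'M[R[i]]_n, A = L ^t* *m L.
Proof.
move=> [hA psdA].
have [P [D [PP AE]]] : exists (P : 'M[R[i]]_n) (D : 'rV_n),
    P *m P ^t* = 1%:M /\ A = P ^t* *m diag_mx D *m P.
  exists (spectralmx A), (spectral_diag A).
  rewrite (unitarymxP (spectral_unitarymx A)); split=> //.
  have /hermitian_normalmx/orthomx_spectralP := hA.
  by rewrite invmx_unitary ?spectral_unitarymx.
(* The form at the [j]-th eigenvector, a column of [P ^t*], equals the eigenvalue. *)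
have D0 j : 0 <= D 0 j.
  have := psdA (P ^t* *m delta_mx j 0).
  rewrite trmx_mul map_mxM trmxCK AE -!mulmxA.
     rewrite (mulmxA P) PP mul1mx (mulmxA P) PP mul1mx.
  by rewrite trmx_delta map_delta_mx -rowE -colE !mxE eqxx mulr1n.
exists (diag_mx (\row_j sqrtC (D 0 j)) *m P).
rewrite trmx_mul map_mxM mulmxA -(mulmxA (P ^t*)) AE; congr (_ *m _ *m _).
rewrite tr_diag_mx map_diag_mx mulmx_diag; congr diag_mx.
apply/rowP => j; rewrite !mxE -normCKC ger0_norm ?sqrtC_ge0//.
by rewrite sqrtCK.
Qed.

(** Gram factors [L j] of the [B j] tensor to a Gram factor of their tensor product, so the sum is
    the squared norm of the vector [z]. The [B j] may differ, as expanding powers of a sum of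
    matrices requires. *)
Lemma tensor_form_ge0 (R : realType) (n m : nat) (B : 'I_m -> 'M[R[i]]_n)
    (S : finType) (Q : pred S) (h : S -> 'I_m -> 'I_n) (v : S -> R[i]) :
  (forall j, psdmx (B j)) ->
  0 <= \sum_(s | Q s) \sum_(t | Q t)
         (v s)^* * v t * \prod_(j < m) B j (h s j) (h t j).
Proof.
move=> psdB; have /fin_all_exists[L BE] := fun j => psdmx_gram (psdB j).
pose z (f : {ffun 'I_m -> 'I_n}) :=
  \sum_(s | Q s) v s * \prod_(j < m) L j (f j) (h s j).
suff -> : \sum_(s | Q s) \sum_(t | Q t)
    (v s)^* * v t * \prod_(j < m) B j (h s j) (h t j) = \sum_f (z f)^* * z f.
  by apply: sumr_ge0 => f _; rewrite mulrC mul_conjC_ge0.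
under [RHS]eq_bigr => f _.
  rewrite rmorph_sum mulr_suml.
  under eq_bigr => s _ do rewrite mulr_sumr.
  over.
rewrite [RHS]exchange_big; apply: eq_bigr => s _ /=.
rewrite [RHS] exchange_big; apply: eq_bigr => t _ /=.
rewrite (eq_bigr (fun j => \sum_k (L j k (h s j))^* * L j k (h t j))).
  rewrite bigA_distr_bigA mulr_sumr; apply: eq_bigr => f _ /=.
  by rewrite big_split rmorphM rmorph_prod /= mulrACA.
by move=> j _; rewrite BE mxE; apply: eq_bigr => k _; rewrite !mxE.
Qed.

Lemma linear_characterM (R : realType) (gT : finGroupType) (G : {group gT})
    (chi : gT -> R[i]) : linear_character G chi ->
  {in G &, {morph chi : s t / (s * t)%g >-> s * t}}.
Proof.
move=> [rG chiE] s t sG tG; rewrite !chiE ?groupM// repr_mxM//.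
by rewrite !trace_mx11 mxE big_ord1.
Qed.

(** Since [s] has finite order, [chi s] is a root of unity. *)
Lemma linear_character_norm (R : realType) (gT : finGroupType) (G : {group gT})
    (chi : gT -> R[i]) : linear_character G chi ->
  {in G, forall s, `|chi s| = 1}.
Proof.
move=> hchi s sG; have chi1 : chi 1%g = 1.
  by case: hchi => rG ->//; rewrite repr_mx1 mxtrace1.
have chiX k : chi (s ^+ k)%g = chi s ^+ k.
  elim: k => [|k IH]; first by rewrite expg0 chi1.
  by rewrite expgS (linear_characterM hchi) ?groupX// IH exprS.
apply/eqP; rewrite -(@pexpr_eq1 _ _ #[s]%g) ?order_gt0//.
by rewrite -normrX -chiX expg_order chi1 normr1.
Qed.

Lemma gen_matrix_fun_tensor (R : realType) (n : nat) (G : {group 'S_n})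
    (chi : 'S_n -> R[i]) (A : 'M[R[i]]_n) : linear_character G chi ->
  #|G|%:R * gen_matrix_fun G chi A =
  \sum_(s in G) \sum_(t in G)
    (chi s)^* * chi t * \prod_(i < n) A (s i) (t i).
Proof.
move=> hchi; rewrite mulr_natl -sumr_const; apply: eq_bigr => s sG.
(* With [t = s * u] the scalar becomes [chi u], as [chi s] has norm 1, and reindexing the product by
   [s] leaves [A i (u i)]: each inner sum is d(A). *)
rewrite [RHS](reindex_inj (mulgI s)) /gen_matrix_fun.
apply: eq_big => u; first by rewrite groupMl.
move=> uG.
rewrite (linear_characterM hchi)// mulrA -normCKC (linear_character_norm hchi)//.
rewrite expr1n mul1r (reindex_inj (@perm_inj _ s)).
by congr (_ * _); apply: eq_bigr => i _; rewrite permM.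
Qed.

(* Grouping rows by the summand they are taken from, d(A_J) is a sum over
   f : 'I_n -> J; each single f need not contribute a nonnegative term to the
   defining sum of d, but it does in the form of gen_matrix_fun_tensor. *)
Lemma gen_matrix_fun_cover (R : realType) (m n : nat) (A : 'I_m -> 'M[R[i]]_n)
    (G : {group 'S_n}) (chi : 'S_n -> R[i]) :
  (forall j, psdmx (A j)) -> linear_character G chi ->
  exists2 w : {ffun 'I_n -> 'I_m} -> R, (forall f, 0 <= w f) &
  forall J : {set 'I_m}, complex.Re (gen_matrix_fun G chi (\sum_(j in J) A j)) =
    cover_sum (fun f : {ffun 'I_n -> 'I_m} => [set f i | i : 'I_n]) w J.
Proof.
move=> psdA hchi.
pose W (f : {ffun 'I_n -> 'I_m}) := #|G|%:R^-1 * \sum_(s in G) \sum_(t in G)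
    (chi s)^* * chi t * \prod_(i < n) A (f i) (s i) (t i).
exists (fun f => complex.Re (W f)) => [f|J].
  have : 0 <= W f.
    rewrite mulr_ge0 ?invr_ge0 ?ler0n//.
    apply: (@tensor_form_ge0 R n n (fun i => A (f i)) _ (mem G)
      (fun s => (s : 'I_n -> 'I_n)) chi) => j; exact: psdA.
  by rewrite lecE => /andP[].
have ReD : {morph @complex.Re R : x y / x + y} by case=> ? ? [].
rewrite /cover_sum -(big_morph _ ReD (erefl : complex.Re 0 = 0)); congr complex.Re.
have G0 : #|G|%:R != 0 :> R[i] by rewrite pnatr_eq0 -lt0n cardG_gt0.
apply: (mulfI G0); rewrite gen_matrix_fun_tensor// -mulr_sumr mulrA divff// mul1r.
rewrite [RHS]exchange_big; apply: eq_bigr => s _ /=.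
rewrite [RHS]exchange_big; apply: eq_bigr => t _ /=.
rewrite -mulr_sumr; congr (_ * _).
rewrite (eq_bigr (fun i => \sum_(j in J) A j (s i) (t i))) => [|i _]; last first.
  by rewrite summxE.
(* Distributing the product leaves the maps [f] with all values in [J], that is, with image
   contained in [J]. *)
rewrite bigA_distr_big; apply: eq_bigl => f.
apply/ffun_onP/subsetP => [fJ _ /imsetP[i _ ->]//|fJ i].
by apply: fJ; apply: imset_f.
Qed.

Theorem theorem3p5 (R : realType) (m n : nat) (hm : (1 <= m)%N) (hn : (1 <= n)%N)
    (A : 'I_m -> 'M[R[i]]_n) (hA : forall j : 'I_m, psdmx (A j))
    (r : R) (hr : r = 1 \/ 2 <= r)
    (k l p : nat) (hk : (1 <= k)%N) (hkl : (k < l)%N) (hlp : (l < p)%N)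
    (hpm : (p <= m)%N)
    (G : {group 'S_n}) (chi : 'S_n -> R[i]) (hchi : linear_character G chi) :
  (l%:R - k%:R) / (p%:R * 'C(m, p)%:R) * sum_pow (gen_matrix_fun G chi) A r p
  + (p%:R - l%:R) / (k%:R * 'C(m, k)%:R) * sum_pow (gen_matrix_fun G chi) A r k
  >= (p%:R - k%:R) / (l%:R * 'C(m, l)%:R) * sum_pow (gen_matrix_fun G chi) A r l.
Proof.
have [w w0 wE] := gen_matrix_fun_cover hA hchi.
set P := fun f : {ffun 'I_n -> 'I_m} => [set f i | i : 'I_n] in wE.
pose phi i := sum_pow (gen_matrix_fun G chi) A r i / (i%:R * 'C(m, i)%:R).
have sumE i : sum_pow (gen_matrix_fun G chi) A r i =
    \sum_(J : {set 'I_m} | #|J| == i) cover_sum P w J `^ r.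
  by apply: eq_bigr => J _; rewrite wE.
suff : (p%:R - k%:R) * phi l <= (l%:R - k%:R) * phi p + (p%:R - l%:R) * phi k.
  by rewrite /phi !(mulrCA _ (sum_pow _ _ _ _)) ![sum_pow _ _ _ _ * _]mulrC.
apply: convex_seq_three_points => // j kj jp; rewrite /phi !sumE.
have := @card_mean_convex R 'I_m (fun J => cover_sum P w J `^ r) j.
rewrite card_ord; apply.
- exact: powR_ge0.
- by move=> T a b c _ _ _; apply: third_diff_powR_ge0.
- exact: leq_trans kj.
- exact: leq_trans hpm.
Qed.
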